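(* Let $m\geq 2$ be an integer. Then both $P_{m,1}$ and $P_{m,2}$ are $2$-special polynomials.
   Context: Let $f_c(z)=z^2+c$ and define $a_i\in\mathbb{Z}[c]$ by $a_1=c$, $a_{i+1}=a_i^2+c$, $a_0=0$. For $m\geq2$, $n\geq1$ the Misiurewicz polynomial is $G_{m,n}(c)=\prod_{k\mid n}\big(a_{m+k-1}+a_{m-1}\big)^{\mu(n/k)}\cdot\epsilon$, where $\epsilon=\prod_{k\mid n}a_k^{-\mu(n/k)}$ if $n\mid m-1$ and $\epsilon=1$ otherwise ($\mu$ the Möbius function); it is monic in $\mathbb{Z}[c]$. For a root $\alpha$ of $G_{m,n}$, $\lambda_{m,n}(\alpha)=2^n\prod_{i=0}^{n-1}a_{m+i}(\alpha)$ is the multiplier of the $n$-cycle $\{a_m(\alpha),\dots,a_{m+n-1}(\alpha)\}$ of $f_\alpha$, and $P_{m,n}(x)=\prod_{j}(x-\lambda_{m,n}(c_j))\in\mathbb{Z}[x]$, the product over the roots $c_j$ of $G_{m,n}$. A monic $P(x)=x^i+A_{i-1}x^{i-1}+\dots+A_0\in\mathbb{Z}[x]$ is $2$-special if $v_2(A_{i-1})\geq 2$ and $v_2(A_j)>v_2(A_{i-1})$ for $j=0,\dots,i-2$ (with $v_2(0)=+\infty$). *)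

(* Defs.v *)
From HB Require Import structures.
From Stdlib Require Import ClassicalEpsilon.
From mathcomp Require Import all_boot all_order all_algebra all_field.
Set Implicit Arguments.
Unset Strict Implicit.
Unset Printing Implicit Defensive.
Import Order.TTheory GRing.Theory Num.Theory.
Local Open Scope ring_scope.

Definition mobius (n : nat) : int :=
  if all (fun p => logn p n == 1%N) (primes n) then (-1) ^+ size (primes n)
  else 0.

(* The variable 'X plays the role of the parameter c. *)
Fixpoint crit_orbit (i : nat) : {poly int} :=
  if i is j.+1 then crit_orbit j ^+ 2 + 'X else 0.

Local Notation a := crit_orbit.
Local Notation "p %:F" := (@FracField.tofrac {poly int} p).
Local Notation toC p := (map_poly (intr : int -> algC) p).

(* The Moebius products, computed in the field of fractions of Z[c]; the
   exponents are integers (exprz). *)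
Definition misiurewicz_eps (m n : nat) : {fraction {poly int}} :=
  if (n %| m.-1)%N then \prod_(k <- divisors n) (a k)%:F ^ (- mobius (n %/ k))
  else 1.

Definition misiurewicz_frac (m n : nat) : {fraction {poly int}} :=
  (\prod_(k <- divisors n)
      (a (m + k).-1 + a m.-1)%:F ^ mobius (n %/ k)) * misiurewicz_eps m n.

(* G_{m,n}: the polynomial in Z[c] equal to the fraction above, which is unique
   when it exists because Z[c] embeds in its field of fractions. *)
Definition misiurewicz (m n : nat) : {poly int} :=
  epsilon (inhabits 0) (fun G => G%:F = misiurewicz_frac m n).

(* The roots in algC, listed with multiplicity. *)
Definition roots_seq (p : {poly algC}) : seq algC :=
  sval (closed_field_poly_normal p).

Definition multiplier (m n : nat) (alpha : algC) : algC :=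
  2 ^+ n * \prod_(i < n) (toC (a (m + i))).[alpha].

Definition multiplier_polyC (m n : nat) : {poly algC} :=
  \prod_(c <- roots_seq (toC (misiurewicz m n))) ('X - (multiplier m n c)%:P).

(* P_{m,n}: the unique preimage in Z[x] of the product above. *)
Definition multiplier_poly (m n : nat) : {poly int} :=
  epsilon (inhabits 0) (fun P => toC P = multiplier_polyC m n).

(* 2-adic valuation of an integer; None stands for +oo. *)
Definition v2 (z : int) : option nat :=
  if z == 0 then None else Some (logn 2 `|z|).

Definition val_le (x y : option nat) : bool :=
  match x, y with
  | _, None => true
  | None, Some _ => false
  | Some s, Some t => (s <= t)%N
  end.

Definition val_lt (x y : option nat) : bool := ~~ val_le y x.

(* deg P = i.+1, so that the coefficient A_{deg P - 1} exists and is P`_i. *)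
Definition two_special (P : {poly int}) : Prop :=
  exists i : nat,
    [/\ P \is monic,
        size P = i.+2,
        val_le (Some 2) (v2 P`_i)
      & forall j : nat, (j < i)%N -> val_lt (v2 P`_i) (v2 P`_j)].

(* Main.v *)
(** Write [A = a_(m-1)].  For a polynomial [L] the rescaled orbit
    [K_i = 2^(2^i) a_i(L / 4)] has integer coefficients, because
    [K_(i+1) = K_i^2 + 2^(2^(i+1) - 2) L].  Squaring turns
    [X^d - 2^e X^(d-1)] modulo [2^(e+1)] into [X^(2d) - 2^(e+1) X^(2d-1)] modulo
    [2^(e+2)] for [e >= 2], so [K_i] keeps this shape as [i] grows, and so do
    its perturbations by multiples of a large power of 2.

    [n = 2]: the numerator of [G_(m,2)] is [H = a_m - A + 1], and the multiplier
    at a root [c] of [H] is [4 (c + 1)].  Hence [H(X/4 - 1)], rescaled, has the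
    multipliers as roots, and it is a combination of rescaled orbits for
    [L = X - 4].

    [n = 1]: at a root [c] of [F = a_m + A] the number [x = a_m(c)] is a fixed
    point, so that [c = x - x^2], and [F(X - X^2)] factors as
    [(A(X - X^2) + X) (A(X - X^2) + 1 - X)].  The second factor vanishes at [x]
    only if [x = 1/2] and [A(1/4) = -1/2], which is impossible since [A] has
    nonnegative coefficients.  Therefore the fixed points [x] are, with
    multiplicities, the roots of the first factor, and the multipliers [2 x] are
    those of a perturbed rescaled orbit for [L = 2 X - X^2].

    The roots [c = 0] of [F] and [c = -1] of [H] that are not roots of [G_(m,n)]
    have multiplier 0 and contribute only powers of [X]. *)

From Stdlib Require Import ClassicalEpsilon.
Require Import Defs.
From mathcomp Require Import all_boot all_order all_algebra all_field.
From mathcomp Require Import ring zify.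
Import Order.TTheory GRing.Theory Num.Theory.

Section MultiplierPolynomials.

Set Implicit Arguments.
Unset Strict Implicit.
Unset Printing Implicit Defensive.

Local Open Scope ring_scope.

Definition monic_of_degree (R : nzRingType) (d : nat) (p : {poly R}) : Prop :=
  p \is monic /\ size p = d.+1.

Lemma monic_of_degree_Xn (R : nzRingType) d :
  monic_of_degree d ('X^d : {poly R}).
Proof. by rewrite /monic_of_degree monicXn size_polyXn. Qed.

Lemma monic_of_degreeD (R : nzRingType) d (p q : {poly R}) :
  monic_of_degree d p -> (size q <= d)%N -> monic_of_degree d (p + q).
Proof.
by move=> [/monicP mp szp] szq; split; rewrite ?monicE ?lead_coefDl ?size_polyDl
  ?szp ?mp.
Qed.

Lemma monic_of_degreeM (R : nzRingType) d e (p q : {poly R}) :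
  monic_of_degree d p -> monic_of_degree e q -> monic_of_degree (d + e) (p * q).
Proof.
move=> [mp szp] [mq szq]; split; first by rewrite rpredM.
by rewrite size_monicM ?monic_neq0 // szp szq addnS.
Qed.

Lemma monic_of_degree_sqr (R : nzRingType) d (p : {poly R}) :
  monic_of_degree d p -> monic_of_degree (2 * d) (p ^+ 2).
Proof. by rewrite mul2n -addnn; move=> dp; apply: monic_of_degreeM. Qed.

Lemma prod_XsubC_image (F : fieldType) (rs : seq F) (h : F -> F)
    (q T U : {poly F}) :
  monic_of_degree (size rs) T ->
  (\prod_(c <- rs) ('X - c%:P)) \Po q = T * U ->
  {in rs, forall c, q.[h c] = c} -> {in rs, forall c, ~~ root U (h c)} ->
  \prod_(c <- rs) ('X - (h c)%:P) = T.
Proof.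
move=> [mT szT] eTU qh Uh; set S := LHS.
have cop : coprimep S U.
  rewrite /S big_seq; elim/big_ind: _ => [|p p' cp cp'|c crs].
  - exact: coprime1p.
  - by rewrite coprimepMl cp.
  - by rewrite coprimep_sym coprimep_XsubC Uh.
have dvd : S %| T.
  rewrite -(Gauss_dvdpl _ cop) -eTU rmorph_prod /S !big_seq.
  elim/big_ind2: _ => [|p1 p2 p3 p4|c crs]; [exact: dvdpp | exact: dvdp_mul |].
  by rewrite dvdp_XsubCl rootE /= comp_polyB comp_polyX comp_polyC !hornerE qh
    // subrr.
apply/eqP; rewrite -eqp_monic ?monic_prod_XsubC //.
by rewrite -dvdp_size_eqp // size_prod_XsubC szT.
Qed.

(* [P = X^d - 2^e X^(d-1)] modulo [2^(e+1)], a form of 2-speciality in which the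
   valuation of the subleading coefficient is explicit. *)
Definition two_special_at (e d : nat) (P : {poly int}) : Prop :=
  monic_of_degree d P /\
  exists r, P = 'X^d - 2 ^+ e *: 'X^(d.-1) + 2 ^+ e.+1 *: r.

Lemma two_special_at_explicit e d (r : {poly int}) :
  (0 < d)%N -> (size r <= d)%N ->
  two_special_at e d ('X^d - 2 ^+ e *: 'X^(d.-1) + 2 ^+ e.+1 *: r).
Proof.
move=> d0 szr; split; last by exists r.
rewrite -addrA; apply: monic_of_degreeD; first exact: monic_of_degree_Xn.
rewrite -scaleNr (leq_trans (size_polyD _ _)) // geq_max.
by rewrite !(leq_trans (size_scale_leq _ _)) // size_polyXn prednK.
Qed.

Lemma two_special_atD e d k (P q : {poly int}) :
  two_special_at e d P -> (e < k)%N -> (size q <= d)%N ->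
  two_special_at e d (P + 2 ^+ k *: q).
Proof.
move=> [dP [r eP]] ek szq; split.
  by apply: monic_of_degreeD => //; rewrite (leq_trans (size_scale_leq _ _)).
exists (r + 2 ^+ (k - e.+1) *: q).
by rewrite scalerDr scalerA -exprD subnKC // addrA -eP.
Qed.

Lemma two_special_at_sqr e d (P : {poly int}) : (1 < e)%N -> (0 < d)%N ->
  two_special_at e d P -> two_special_at e.+1 (2 * d) (P ^+ 2).
Proof.
case: e d => [|[|e]] // [|n] // _ _ [dP [r eP]].
split; first exact: monic_of_degree_sqr.
exists (2 ^+ e *: 'X^(2 * n) + r * ('X^(n.+1) - 2 ^+ e.+2 *: 'X^n)
        + 2 ^+ e.+2 *: r ^+ 2).
have [-> ->] : (2 * n.+1 = n + n + 2 /\ (n + n + 2).-1 = n + n + 1)%N by lia.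
by rewrite eP -!mul_polyC mul2n -addnn /= !exprD !(exprS _ n) !(exprS 2); ring.
Qed.

Lemma two_special_at_drop e k d (P : {poly int}) : (0 < d)%N ->
  two_special_at e (k + d) P -> two_special_at e d (drop_poly k P).
Proof.
move=> d0 [[/monicP mP szP] [r eP]]; split.
  have szd : size (drop_poly k P) = d.+1.
    by rewrite size_drop_poly szP -addnS addKn.
  split=> //; rewrite monicE lead_coefE szd coef_drop_poly.
  by rewrite -mP lead_coefE szP addnC.
exists (drop_poly k r).
have dX j : drop_poly k 'X^(k + j) = 'X^j :> {poly int}.
  by rewrite addnC exprD drop_polyMXn_id.
rewrite {}eP -scaleNr !drop_polyD !drop_polyZ -{2}(prednK d0) addnS.
by rewrite !dX scaleNr.
Qed.

Lemma v2_pow_oddM e (x : int) : v2 (2 ^+ e * (2 * x - 1)) = Some e.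
Proof.
have x0 : 2 * x - 1 != 0 by lia.
rewrite /v2 mulf_eq0 expf_eq0 /= andbF (negPf x0) abszM.
rewrite lognM ?absz_gt0 ?expf_neq0 // abszX pfactorK //.
by rewrite [logn 2 `|(2 * x - 1)%R|]logn_coprime ?addn0 // coprime2n; lia.
Qed.

Lemma v2_powM_gt e k (x : int) : (e < k)%N -> val_lt (Some e) (v2 (2 ^+ k * x)).
Proof.
move=> ek; rewrite /val_lt /v2; case: eqVneq => //=.
rewrite mulf_eq0 negb_or -ltnNge => /andP[_ x0].
by rewrite abszM lognM ?absz_gt0 ?expf_neq0 // abszX pfactorK // ltn_addr.
Qed.

Lemma two_special_atW e d (P : {poly int}) : (1 < e)%N -> (0 < d)%N ->
  two_special_at e d P -> two_special P.
Proof.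
case: d => // n e2 _ [[mP szP] [r eP]].
have v2n : v2 P`_n = Some e.
  rewrite -(v2_pow_oddM e r`_n) eP coefD coefB !coefZ !coefXn /=.
  rewrite (ltn_eqF (ltnSn n)) eqxx.
  by congr v2; rewrite mulr0n mulr1n exprS; ring.
exists n; split=> // [|j jn]; rewrite v2n //.
rewrite eP coefD coefB !coefZ !coefXn (ltn_eqF jn) (ltn_eqF (leqW jn)).
by rewrite mulr0 subr0 add0r v2_powM_gt.
Qed.

Local Notation a := crit_orbit.
Local Notation "p %:F" := (@FracField.tofrac {poly int} p).
Local Notation toC p := (map_poly (intr : int -> algC) p).
Local Arguments crit_orbit : simpl never.

Lemma crit_orbitS i : a i.+1 = a i ^+ 2 + 'X.
Proof. by []. Qed.

Lemma crit_orbit1 : a 1 = 'X.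
Proof. by rewrite crit_orbitS expr0n add0r. Qed.

Lemma monic_of_degree_crit_orbit i : monic_of_degree (2 ^ i) (a i.+1).
Proof.
elim: i => [|i IHi]; first by rewrite crit_orbit1; apply: monic_of_degree_Xn.
rewrite crit_orbitS expnS; apply: monic_of_degreeD.
  exact: monic_of_degree_sqr.
by rewrite size_polyX leq_pmulr // expn_gt0.
Qed.

Lemma size_crit_orbit_le i : (size (a i) <= 2 ^ i)%N.
Proof.
case: i => [|i]; first by rewrite size_poly0.
by have [_ ->] := monic_of_degree_crit_orbit i; rewrite ltn_exp2l.
Qed.

Lemma monic_of_degree_crit_orbitD i : monic_of_degree (2 ^ i) (a i.+1 + a i).
Proof.
apply: monic_of_degreeD (size_crit_orbit_le i).
exact: monic_of_degree_crit_orbit.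
Qed.

Lemma crit_orbit_at0 i : (a i).[0] = 0.
Proof.
elim: i => [|i IHi]; first by rewrite horner0.
by rewrite crit_orbitS !hornerE IHi expr0n.
Qed.

Lemma crit_orbit_atN1 i : (a i).[-1] = - (odd i)%:R.
Proof.
elim: i => [|i IHi]; first by rewrite horner0 oppr0.
by rewrite crit_orbitS !hornerE IHi /=; case: (odd i).
Qed.

Lemma toC_crit_orbitS i : toC (a i.+1) = toC (a i) ^+ 2 + 'X.
Proof. by rewrite crit_orbitS rmorphD rmorphXn /= map_polyX. Qed.

Lemma toC_crit_orbit_ge0 i x : 0 <= x -> 0 <= (toC (a i)).[x].
Proof.
move=> x0; elim: i => [|i IHi]; first by rewrite rmorph0 horner0.
by rewrite toC_crit_orbitS !hornerE addr_ge0 ?exprn_ge0.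
Qed.

Lemma horner_toC_int (p : {poly int}) (c : int) :
  (toC p).[(c%:~R : algC)] = (p.[c])%:~R.
Proof. exact: (horner_map (intr : {rmorphism int -> algC})). Qed.

Lemma toC_inj (p q : {poly int}) : toC p = toC q -> p = q.
Proof. by apply: map_inj_poly => //; apply: intr_inj. Qed.

Lemma monic_of_degree_toC d (p : {poly int}) :
  monic_of_degree d (toC p) <-> monic_of_degree d p.
Proof.
rewrite /monic_of_degree size_map_inj_poly //; last exact: intr_inj.
rewrite !monicE lead_coef_map_inj //; last exact: intr_inj.
by rewrite -(inj_eq (@intr_inj algC)).
Qed.

Lemma roots_seqE (p : {poly algC}) : p \is monic ->
  p = \prod_(c <- roots_seq p) ('X - c%:P).
Proof.
rewrite /roots_seq => mp.
by case: closed_field_poly_normal => r /= {1}->; rewrite (monicP mp) scale1r.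
Qed.

Lemma misiurewicz_quotient m n (D G : {poly int}) : D != 0 ->
  misiurewicz_frac m n = (D * G)%:F / D%:F -> misiurewicz m n = G.
Proof.
move=> D0; rewrite tofracM mulrAC divff ?tofrac_eq0 // mul1r => eG.
apply/eqP; rewrite -tofrac_eq -eG; apply/eqP.
exact: (epsilon_spec (inhabits 0)
  (fun H : {poly int} => H%:F = _) (ex_intro _ G (esym eG))).
Qed.

Lemma multiplier_polyE m n (P : {poly int}) :
  toC P = multiplier_polyC m n -> multiplier_poly m n = P.
Proof.
move=> eP; apply: toC_inj; rewrite eP.
exact: (epsilon_spec (inhabits 0)
  (fun Q : {poly int} => toC Q = _) (ex_intro _ P eP)).
Qed.

(* As [c0] has multiplier 0, the spurious factor [('X - c0%:P) ^+ k] of [F]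
   contributes a factor ['X^k] to [T]. *)
Lemma two_special_multiplier_poly m n d k (c0 : int) (F T : {poly int})
    (q U : {poly algC}) :
  ('X - c0%:P) ^+ k * misiurewicz m n = F -> multiplier m n c0%:~R = 0 ->
  (k < d)%N -> monic_of_degree d F ->
  (exists2 e, (1 < e)%N & two_special_at e d T) ->
  toC F \Po q = toC T * U ->
  (forall c, root (toC F) c ->
     q.[multiplier m n c] = c /\ ~~ root U (multiplier m n c)) ->
  two_special (multiplier_poly m n).
Proof.
move=> eF mult0 kd dF [e e2 eT] FqTU mult_root.
have mG : misiurewicz m n \is monic.
  by have [mF _] := dF; rewrite -(monicMl _ (monic_exp k (monicXsubC c0))) eF.
pose rs := nseq k c0%:~R ++ roots_seq (toC (misiurewicz m n)).
have eFrs : toC F = \prod_(c <- rs) ('X - c%:P).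
  rewrite big_cat big_nseq iter_mulr_1 -roots_seqE ?monic_map //.
  by rewrite -eF rmorphM rmorphXn rmorphB /= map_polyX map_polyC.
have Frs c : c \in rs -> root (toC F) c by rewrite eFrs root_prod_XsubC.
have drs : size rs = d.
  have [_] := (monic_of_degree_toC d F).2 dF.
  by rewrite eFrs size_prod_XsubC => -[].
have eXkP : 'X^k * multiplier_polyC m n = toC T.
  rewrite -(@prod_XsubC_image _ rs (multiplier m n) q (toC T) U) -?eFrs //.
  - by rewrite big_cat big_nseq iter_mulr_1 mult0 subr0.
  - by rewrite drs monic_of_degree_toC; case: eT.
  - by move=> c /Frs/mult_root[].
  - by move=> c /Frs/mult_root[].
rewrite (@multiplier_polyE _ _ (drop_poly k T)).
  apply: (two_special_atW e2 (d := d - k)); first by rewrite subn_gt0.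
  by apply: two_special_at_drop; rewrite ?subn_gt0 // subnKC // ltnW.
apply/polyP => i; rewrite coef_map coef_drop_poly -coef_map /= -eXkP.
by rewrite coefXnM ltnNge leq_addl /= addnK.
Qed.

Fixpoint scaled_orbit (L : {poly int}) (i : nat) : {poly int} :=
  if i is j.+1 then scaled_orbit L j ^+ 2 + 2 ^+ (2 ^ j.+1 - 2) *: L else 0.

Lemma scaled_orbitS L i :
  scaled_orbit L i.+1 = scaled_orbit L i ^+ 2 + 2 ^+ (2 ^ i.+1 - 2) *: L.
Proof. by []. Qed.
Local Arguments scaled_orbit : simpl never.

Lemma scaled_orbit1 L : scaled_orbit L 1 = L.
Proof. by rewrite scaled_orbitS expr0n add0r scale1r. Qed.

Lemma scaled_orbit2 L : scaled_orbit L 2 = L ^+ 2 + 4 *: L.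
Proof. by rewrite scaled_orbitS scaled_orbit1. Qed.

Lemma toC_scaled_orbit L i :
  toC (scaled_orbit L i) = 2 ^+ (2 ^ i) *: (toC (a i) \Po (4^-1 *: toC L)).
Proof.
elim: i => [|i IHi]; first by rewrite !rmorph0 scaler0.
rewrite scaled_orbitS toC_crit_orbitS rmorphD rmorphXn /= map_polyZ IHi.
rewrite comp_polyD [(_ ^+ 2) \Po _]rmorphXn comp_polyX scalerDr exprZn scalerA.
rewrite -exprM -expnSr /= rmorphXn /=; congr (_ + _ *: _).
have le2 : (2 <= 2 ^ i.+1)%N by rewrite (leq_exp2l 1).
have -> : 4 = 2 ^+ 2 :> algC by rewrite -natrX.
by rewrite -[in RHS](subnK le2) exprD mulfK // expf_neq0 // pnatr_eq0.
Qed.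

Lemma two_special_at_scaled_orbit (L : {poly int}) d i :
  (0 < d)%N -> (size L <= d)%N -> two_special_at 2 d (scaled_orbit L 2) ->
  two_special_at i.+2 (2 ^ i * d) (scaled_orbit L i.+2).
Proof.
move=> d0 szL d2; elim: i => [|i IHi]; first by rewrite mul1n.
rewrite scaled_orbitS; apply: two_special_atD.
- rewrite expnS -mulnA; apply: two_special_at_sqr => //.
  by rewrite muln_gt0 expn_gt0.
- by have := ltn_expl i.+2 (ltnSn 1); rewrite (expnS 2 i.+2); lia.
- by rewrite (leq_trans szL) // leq_pmull // expn_gt0.
Qed.

Lemma misiurewicz1 i : 'X * misiurewicz i.+1 1 = a i.+1 + a i.
Proof.
have /factor_theorem [G] : root (a i.+1 + a i) 0.
  by rewrite rootE hornerD !crit_orbit_at0 addr0.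
rewrite subr0 mulrC => eG; rewrite eG; congr (_ * _).
apply: (misiurewicz_quotient (D := 'X)); first by rewrite polyX_eq0.
rewrite -eG /misiurewicz_frac /misiurewicz_eps dvd1n !big_seq1 divnn addn1 /=.
by rewrite crit_orbit1 expr1z exprN1.
Qed.

Definition crit_orbit_ratio i : {poly int} := a i.+1 - a i + 1.

Lemma crit_orbit_ratioE i : a i.+2 + a i = (a i.+1 + a i) * crit_orbit_ratio i.
Proof.
by rewrite /crit_orbit_ratio !(crit_orbitS i.+1) !(crit_orbitS i); ring.
Qed.

Lemma monic_of_degree_crit_orbit_ratio i :
  monic_of_degree (2 ^ i) (crit_orbit_ratio i).
Proof.
rewrite /crit_orbit_ratio -addrA; apply: monic_of_degreeD.
  exact: monic_of_degree_crit_orbit.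
rewrite (leq_trans (size_polyD _ _)) // geq_max size_polyN size_crit_orbit_le.
by rewrite size_poly1 expn_gt0.
Qed.

Lemma misiurewicz2 i :
  ('X - (-1)%:P) ^+ (2 %| i) * misiurewicz i.+1 2 = crit_orbit_ratio i.
Proof.
have [G eG] : exists G, crit_orbit_ratio i = ('X - (-1)%:P) ^+ (2 %| i) * G.
  case: (boolP (2 %| i)%N) => [|_]; last first.
    by exists (crit_orbit_ratio i); rewrite mul1r.
  rewrite dvdn2 => evi.
  have /factor_theorem [G ->] : root (crit_orbit_ratio i) (-1).
    by rewrite rootE /crit_orbit_ratio !hornerE !crit_orbit_atN1 /= (negPf evi).
  by exists G; rewrite mulrC.
rewrite eG; congr (_ * _).
apply: (misiurewicz_quotient (D := ('X - (-1)%:P) ^+ (2 %| i))).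
  by rewrite monic_neq0 // monic_exp // monicXsubC.
have [mF _] := monic_of_degree_crit_orbitD i.
have F0 : (a i.+1 + a i)%:F != 0 by rewrite tofrac_eq0 monic_neq0.
have a2 : a 2 = 'X * ('X - (-1)%:P).
  by rewrite crit_orbitS crit_orbit1 polyCN opprK; ring.
rewrite -eG /misiurewicz_frac /misiurewicz_eps !big_cons !big_nil !mulr1.
rewrite addn1 addn2 -[mobius (2 %/ 1)]/(- 1) -[mobius (2 %/ 2)]/1 opprK /=.
rewrite crit_orbit_ratioE tofracM !expr1z !exprN1 mulKf //.
case: (2 %| i)%N; last by rewrite expr0 tofrac1 invr1.
have X0 : ('X)%:F != 0 by rewrite tofrac_eq0 polyX_eq0.
by rewrite a2 crit_orbit1 expr1 tofracM invfM (mulVKf X0).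
Qed.

Definition fixed_point_poly i : {poly int} :=
  scaled_orbit (2 *: 'X - 'X^2) i + 2 ^+ (2 ^ i - 1) *: 'X.

(* For [i = 0] the leading term comes from [2 X - X^2] itself, which is not
   monic; afterwards it comes from a square. *)
Lemma two_special_at_fixed_point_poly i :
  exists2 e, (1 < e)%N &
    two_special_at e (2 ^ i.+1) ((-1) ^+ (i == 0%N) *: fixed_point_poly i.+1).
Proof.
rewrite /fixed_point_poly; case: i => [|i] /=.
  exists 2%N => //; rewrite scaled_orbit1.
  have -> : -1 *: (2 *: 'X - 'X^2 + 2 ^+ (2 ^ 1 - 1) *: 'X) =
            'X^2 - 2 ^+ 2 *: 'X^(2.-1) + 2 ^+ 3 *: 0 :> {poly int}.
    by rewrite -!mul_polyC; ring.
  by apply: two_special_at_explicit; rewrite ?size_poly0.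
exists i.+2 => //; rewrite scale1r; apply: two_special_atD.
- have -> : (2 ^ i.+2 = 2 ^ i * 4)%N by rewrite !expnS; lia.
  apply: two_special_at_scaled_orbit => //.
    by rewrite (leq_trans (size_polyD _ _)) // size_polyN size_polyXn geq_max
      (leq_trans (size_scale_leq _ _)) // size_polyX.
  have -> : scaled_orbit (2 *: 'X - 'X^2) 2 =
            'X^4 - 2 ^+ 2 *: 'X^(4.-1) + 2 ^+ 3 *: 'X :> {poly int}.
    by rewrite scaled_orbit2 -!mul_polyC; ring.
  by apply: two_special_at_explicit; rewrite ?size_polyX.
- by rewrite !expnS; have := ltn_expl i (ltnSn 1); lia.
- by rewrite size_polyX (leq_exp2l 1).
Qed.

Lemma toC_fixed_point_poly i : let z := 2^-1 *: 'X in
  toC (fixed_point_poly i) = 2 ^+ (2 ^ i) *: (toC (a i) \Po (z - z ^+ 2) + z).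
Proof.
move=> z; rewrite rmorphD /= toC_scaled_orbit.
have -> : 4^-1 *: toC (2 *: 'X - 'X^2) = z - z ^+ 2.
  rewrite rmorphB /= map_polyZ map_polyX map_polyXn scalerBr scalerA exprZn.
  by congr (_ *: _ - _ *: _); field.
rewrite map_polyZ map_polyX /= rmorphXn scalerDr scalerA; congr (_ + _ *: _).
by rewrite -[in RHS](subnK (expn_gt0 2 i)) exprD mulfK // pnatr_eq0.
Qed.

Lemma crit_orbitD_root i c : root (toC (a i.+1 + a i)) c ->
  c = - (toC (a i)).[c] - (toC (a i)).[c] ^+ 2.
Proof.
rewrite rootE rmorphD /= toC_crit_orbitS !hornerE => /eqP Fc.
by apply/eqP; rewrite -subr_eq0 -[X in _ == X]Fc; apply/eqP; ring.
Qed.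

(* Otherwise [c = 1/4], where the orbit is nonnegative. *)
Lemma crit_orbit_neq_Nhalf i c : root (toC (a i.+1 + a i)) c ->
  (toC (a i)).[c] != - 2^-1.
Proof.
move=> /crit_orbitD_root ec; apply/eqP => y_half.
have c_ge0 : 0 <= c.
  rewrite ec y_half; have -> : - - 2^-1 - (- 2^-1) ^+ 2 = 4^-1 :> algC by field.
  by rewrite invr_ge0.
by have := toC_crit_orbit_ge0 i c_ge0; rewrite y_half oppr_ge0 invr_le0 lern0.
Qed.

Lemma multiplier1 i c : root (toC (a i.+1 + a i)) c ->
  multiplier i.+1 1 c = - 2 * (toC (a i)).[c].
Proof.
rewrite /multiplier big_ord1 addn0 => /crit_orbitD_root.
rewrite toC_crit_orbitS !hornerE; set y := (toC (a i)).[c] => ->; ring.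
Qed.

Lemma crit_orbitD_comp i (z : {poly algC}) :
  toC (a i.+1 + a i) \Po (z - z ^+ 2) =
  (toC (a i) \Po (z - z ^+ 2) + z) * (toC (a i) \Po (z - z ^+ 2) + 1 - z).
Proof.
by rewrite rmorphD /= toC_crit_orbitS !comp_polyD comp_polyX rmorphXn /=; ring.
Qed.

Lemma two_special_multiplier_poly1 i : two_special (multiplier_poly i.+2 1).
Proof.
pose z : {poly algC} := 2^-1 *: 'X.
pose A := toC (a i.+1) \Po (z - z ^+ 2).
pose s : algC := (-1) ^+ (i == 0%N) * 2 ^+ (2 ^ i.+1).
have s0 : s != 0 by rewrite mulf_neq0 ?signr_eq0 // expf_neq0 // pnatr_eq0.
have eF : ('X - 0%:P) ^+ 1 * misiurewicz i.+2 1 = a i.+2 + a i.+1.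
  by rewrite subr0 expr1 misiurewicz1.
have multiplier0 : multiplier i.+2 1 0%:~R = 0.
  rewrite multiplier1 ?horner_toC_int ?crit_orbit_at0 ?mulr0 //.
  by rewrite rootE horner_toC_int hornerD !crit_orbit_at0.
have FqTU : toC (a i.+2 + a i.+1) \Po (z - z ^+ 2) =
    toC ((-1) ^+ (i == 0%N) *: fixed_point_poly i.+1) * (s^-1 *: (A + 1 - z)).
  rewrite crit_orbitD_comp map_polyZ toC_fixed_point_poly scalerA rmorphXn.
  by rewrite rmorphN1 -/s -/z -/A -scalerAl -scalerAr scalerA mulfV // scale1r.
have d2 : (1 < 2 ^ i.+1)%N by rewrite (ltn_exp2l 0).
apply: (two_special_multiplier_poly eF multiplier0 d2
  (monic_of_degree_crit_orbitD i.+1) (two_special_at_fixed_point_poly i)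
  FqTU).
move=> c Fc; rewrite multiplier1 //.
have := crit_orbit_neq_Nhalf Fc; have := crit_orbitD_root Fc.
set y := (toC (a i.+1)).[c] => ec y_neq.
have zy : z.[- 2 * y] = - y by rewrite hornerZ hornerX; field.
have qy : (z - z ^+ 2).[- 2 * y] = c.
  by rewrite hornerD hornerN horner_exp zy sqrrN.
split=> //; rewrite rootE hornerZ mulf_neq0 ?invr_eq0 //.
rewrite !(hornerD, hornerN) hornerC horner_comp qy zy -/y.
have -> : y + 1 - - y = 2 * (y - - 2^-1) by field.
by rewrite mulf_neq0 ?pnatr_eq0 // subr_eq0.
Qed.

Definition two_cycle_poly i : {poly int} :=
  scaled_orbit ('X - 4) i.+1 - 2 ^+ (2 ^ i) *: scaled_orbit ('X - 4) i
    + (2 ^+ (2 ^ i.+1))%:P.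

Lemma two_special_at_two_cycle_poly i :
  exists2 e, (1 < e)%N & two_special_at e (2 ^ i.+1) (two_cycle_poly i.+1).
Proof.
have K2 : scaled_orbit ('X - 4) 2 =
          'X^2 - 2 ^+ 2 *: 'X^(2.-1) + 2 ^+ 3 *: 0 :> {poly int}.
  by rewrite scaled_orbit2 -!mul_polyC; ring.
rewrite /two_cycle_poly; case: i => [|i].
  exists 3%N => //; rewrite K2 scaled_orbit1.
  set P := (X in two_special_at _ _ X).
  have -> : P = 'X^2 - 2 ^+ 3 *: 'X^(2.-1) + 2 ^+ 4 *: 2%:P.
    by rewrite /P -!mul_polyC; ring.
  by apply: two_special_at_explicit; rewrite ?size_polyC.
have Kat j : two_special_at j.+2 (2 ^ j.+1) (scaled_orbit ('X - 4) j.+2).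
  rewrite expnSr; apply: two_special_at_scaled_orbit => //.
    by rewrite -polyC_natr size_XsubC.
  by rewrite K2; apply: two_special_at_explicit; rewrite ?size_poly0.
exists i.+3 => //.
have -> : forall K K' : {poly int},
    K - 2 ^+ (2 ^ i.+2) *: K' + (2 ^+ (2 ^ i.+3))%:P =
    K + 2 ^+ (2 ^ i.+2) *: ((2 ^+ (2 ^ i.+2))%:P - K').
  by move=> K K'; rewrite (expnSr 2 i.+2) exprM -!mul_polyC; ring.
apply: two_special_atD; first exact: Kat.
- by rewrite !expnS; have := ltn_expl i (ltnSn 1); lia.
rewrite (leq_trans (size_polyD _ _)) // geq_max size_polyN.
have [[_ ->] _] := Kat i.
by rewrite (leq_trans (size_polyC_leq1 _)) ?expn_gt0 // ltn_exp2l ?ltnSn.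
Qed.

Lemma toC_two_cycle_poly i :
  toC (two_cycle_poly i) =
  2 ^+ (2 ^ i.+1) *: (toC (crit_orbit_ratio i) \Po (4^-1 *: 'X - 1)).
Proof.
pose q : {poly algC} := 4^-1 *: 'X - 1.
have qE : 4^-1 *: toC ('X - 4) = q.
  rewrite rmorphB /= map_polyX rmorph_nat scalerBr -(scaler_nat 4 1).
  by rewrite scalerA mulVf ?pnatr_eq0 // scale1r.
rewrite -/q /two_cycle_poly rmorphD rmorphB /= map_polyZ map_polyC.
rewrite !toC_scaled_orbit qE [toC (_ + 1)]rmorphD /= [toC (_ - _)]rmorphB.
rewrite rmorph1 /= comp_polyD comp_polyB [1 \Po q]rmorph1 !rmorphXn /=.
by rewrite scalerA -exprD addnn -mul2n -expnS scalerDr scalerBr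
  alg_polyC rmorphXn.
Qed.

Lemma multiplier2 i c : root (toC (crit_orbit_ratio i)) c ->
  multiplier i.+1 2 c = 4 * (c + 1).
Proof.
rewrite /multiplier !big_ord_recl big_ord0 /= mulr1 addn0 addn1.
rewrite rmorphD rmorphB rmorph1 /= !toC_crit_orbitS rootE.
rewrite !(hornerD, hornerN, horner_exp) hornerX hornerC.
set y := (toC (a i)).[c] => /eqP Hc.
have ec : c = y - 1 - y ^+ 2.
  by apply/eqP; rewrite -subr_eq0 -[X in _ == X]Hc; apply/eqP; ring.
by rewrite ec; ring.
Qed.

Lemma two_special_multiplier_poly2 i : two_special (multiplier_poly i.+2 2).
Proof.
pose s : algC := 2 ^+ (2 ^ i.+2).
have s0 : s != 0 by rewrite expf_neq0 // pnatr_eq0.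
have multiplierN1 : multiplier i.+2 2 (-1)%:~R = 0.
  rewrite /multiplier !big_ord_recl big_ord0 !horner_toC_int !crit_orbit_atN1.
  by rewrite /= addn0 addn1 /= negbK; case: (odd i); rewrite /= !(mulr0, mul0r).
have FqTU : toC (crit_orbit_ratio i.+1) \Po (4^-1 *: 'X - 1) =
    toC (two_cycle_poly i.+1) * s^-1%:P.
  by rewrite toC_two_cycle_poly mulrC mul_polyC scalerA mulVf // scale1r.
have kd : ((2 %| i.+1) < 2 ^ i.+1)%N.
  by rewrite (leq_ltn_trans (leq_b1 _)) // (ltn_exp2l 0).
apply: (two_special_multiplier_poly (misiurewicz2 i.+1) multiplierN1 kd
  (monic_of_degree_crit_orbit_ratio i.+1) (two_special_at_two_cycle_poly i)
  FqTU).
move=> c Hc; rewrite multiplier2 // rootC invr_eq0; split=> //.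
by rewrite hornerD hornerN hornerZ hornerX hornerC; field.
Qed.

End MultiplierPolynomials.

Theorem theorem7p2 (m : nat) (hm : 2 <= m) :
  two_special (multiplier_poly m 1) /\ two_special (multiplier_poly m 2).
Proof.
case: m hm => [|[|i]] // _; split.
  exact: two_special_multiplier_poly1.
exact: two_special_multiplier_poly2.
Qed.
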